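(* Let $\kappa\in(0,1)$ and consider the wideband scalar Rician fading system described in the context, with $H_k\sim\mathcal{CN}(\kappa,1-\kappa^2)$. For every $\eta\ge 1$, the wideband outage exponent is $$\mathcal{E}(\eta)=\frac{1}{(1-\kappa^2)\eta}+\frac{\kappa^2}{1-\kappa^2}-\sqrt{1+\frac{4\kappa^2}{(1-\kappa^2)^2\eta}}+\log\frac{(1-\kappa^2)\eta}{2}+\log\left[1+\sqrt{1+\frac{4\kappa^2}{(1-\kappa^2)^2\eta}}\right].$$
   Context: Setting. There are $K$ parallel channels $Y_k=H_kX_k+Z_k$, $k=1,\ldots,K$, with $Z_k\sim\mathcal{CN}(0,1)$, inputs $X_k\sim\mathcal{CN}(0,\rho/K)$ where $\rho>0$ is the total power, and i.i.d. fading coefficients $H_k$ (distribution not depending on $K$). $\mathcal{CN}(\kappa,\sigma^2)$ is the circular-symmetric complex Gaussian law with mean $\kappa$ and variance $\sigma^2$. The total achievable rate (in nats) is the random variable $$R(K,\rho)=\sum_{k=1}^K\log\left(1+\frac{\rho}{K}|H_k|^2\right).$$ For an energy per nat $\eta>0$, with target rate $r=\rho/\eta$, the wideband outage exponent is $$\mathcal{E}(\eta):=\lim_{K\to\infty}\frac{-\log\Pr[R(K,\rho)\le r]}{K}.$$ All logarithms are natural. *)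

(* Defs.v *)
From HB Require Import structures.
From mathcomp Require Import all_boot all_order all_algebra.
From mathcomp Require Import complex.
From mathcomp Require Import all_classical all_reals all_analysis.

Set Implicit Arguments.
Unset Strict Implicit.
Unset Printing Implicit Defensive.

Import Order.TTheory GRing.Theory Num.Theory.
Import numFieldNormedType.Exports.

Local Open Scope classical_set_scope.
Local Open Scope ring_scope.
Local Open Scope complex_scope.

Definition pair_of_complex (R : Type) (z : R[i]) : R * R :=
  (complex.Re z, complex.Im z).

Definition complex_of_pair (R : Type) (x : R * R) : R[i] := x.1 +i* x.2.

(* R[i] carries the sigma-algebra transported from R * R, that is, its Borel
   sigma-algebra. *)
Definition measurable_complex (R : realType) : set (set R[i]) :=
  preimage_set_system setT (@pair_of_complex R) measurable.

Fact complex_display : measure_display.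
Proof. exact: default_measure_display. Qed.

Section complex_isMeasurable.
Variable R : realType.

Let sigma_algebra_complex : sigma_algebra setT (@measurable_complex R).
Proof. exact/sigma_algebra_preimage/sigma_algebra_measurable. Qed.

Let measurable_complex0 : measurable_complex (@set0 R[i]).
Proof. by case: sigma_algebra_complex. Qed.

Let measurable_complexC (A : set R[i]) :
  measurable_complex A -> measurable_complex (~` A).
Proof. by case: sigma_algebra_complex => _ mC _ /mC; rewrite setTD. Qed.

Let measurable_complex_bigcup (F : (set R[i])^nat) :
  (forall n, measurable_complex (F n)) ->
  measurable_complex (\bigcup_n F n).
Proof. by case: sigma_algebra_complex => _ _; exact. Qed.

HB.instance Definition _ := isPointed.Build R[i] 0.

HB.instance Definition _ := @isMeasurable.Build complex_display R[i]
  (@measurable_complex R) measurable_complex0 measurable_complexC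
  measurable_complex_bigcup.

End complex_isMeasurable.

(* CN(m, v): the real and imaginary parts are independent Gaussians with
   means Re m and Im m, each of variance v / 2, so that E|Z - m|^2 = v.
   The second parameter of normal_prob is the standard deviation.
   Meaningful only for 0 < v. *)
Definition complex_normal_prob (R : realType) (m : R[i]) (v : R)
    (A : set R[i]) : \bar R :=
  (normal_prob (complex.Re m) (Num.sqrt (v / 2)) \x
   normal_prob (complex.Im m) (Num.sqrt (v / 2)))%E
    (@complex_of_pair R @^-1` A).

Definition has_law d d' (T : measurableType d) (T' : measurableType d')
    (R : realType) (P : probability T R) (X : {RV P >-> T'})
    (mu : set T' -> \bar R) : Prop :=
  forall A : set T', measurable A -> distribution P X A = mu A.

Definition mutually_independent d d' (T : measurableType d)
    (T' : measurableType d') (R : realType) (P : probability T R)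
    (I : finType) (X : I -> {RV P >-> T'}) : Prop :=
  forall (J : {set I}) (A : I -> set T'),
    (forall i, i \in J -> measurable (A i)) ->
    P (\bigcap_(i in [set j | j \in J]) (X i @^-1` A i)) =
    (\prod_(i in J) P (X i @^-1` A i))%E.

Section wideband_outage.
Context d (T : measurableType d) (R : realType) (P : probability T R).

(* H K is the family of fading coefficients of the system with K channels. *)
Variable H : forall K : nat, 'I_K -> {RV P >-> R[i]}.
Arguments H : clear implicits.

Definition achievable_rate (K : nat) (rho : R) (t : T) : R :=
  \sum_(k < K) ln (1 + rho / K%:R * Normc.normc (H K k t) ^+ 2).

Definition outage_probability (K : nat) (rho r : R) : \bar R :=
  P [set t | achievable_rate K rho t <= r].

(* lne is the extended logarithm: a zero probability gives the value +oo. *)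
Definition normalized_outage_exponent (rho eta : R) (K : nat) : \bar R :=
  (- lne (outage_probability K rho (rho / eta)) * (K%:R^-1)%:E)%E.

Definition wideband_outage_exponent (rho eta : R) : \bar R :=
  limn (normalized_outage_exponent rho eta).

End wideband_outage.

(* Main.v *)
(** The event R(K, rho) <= rho / eta is, up to the linearization of the
    logarithm, the large deviation event (1/K) sum_k |H_k|^2 <= 1 / eta, so the
    exponent is the Cramer rate sup_s (L(s) - s / eta), where
      L(s) = - log E exp (- s |H|^2) = log (1 + s v) + s kappa^2 / (1 + s v)
    with v = 1 - kappa^2.  The supremum is attained at the root s0 >= 0 of the
    quadratic equation L'(s0) = 1 / eta; eta >= 1 is what makes s0 >= 0.
    Both bounds only use the product formula for E exp (- s sum_k |H_k|^2) with
    s >= 0 and strict concavity of L: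
    - an upper bound on the probability by Chernoff's inequality, where replacing
      (1 + rho |H|^2 / K)^(- s K / rho) by exp (- s |H|^2) costs a vanishing error;
    - a lower bound by log (1 + x) <= x and exponential tilting at s slightly
      above s0, where the tilted law concentrates just below 1 / eta. *)
Require Import Defs.
From HB Require Import structures.
From mathcomp Require Import all_boot all_order all_algebra.
From mathcomp Require Import complex.
From mathcomp Require Import all_classical all_reals all_analysis.
From mathcomp Require Import measurable_realfun measurable_fun_approximation.
From mathcomp Require Import ring lra.

Set Implicit Arguments.
Unset Strict Implicit.
Unset Printing Implicit Defensive.

Import Order.TTheory GRing.Theory Num.Theory.
Import numFieldNormedType.Exports.

Local Open Scope classical_set_scope.
Local Open Scope ring_scope.
Local Open Scope complex_scope.

(** * Integration against the image of a weighted measure *)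

Section weighted_integral.
Local Open Scope ereal_scope.
Context d d' (T : measurableType d) (T' : measurableType d') (R : realType).
Variables (mu : {measure set T -> \bar R}) (nu : {measure set T' -> \bar R}).
Variables (phi : T -> T') (g : T -> R) (c : R).
Hypothesis mphi : measurable_fun setT phi.
Hypothesis mg : measurable_fun setT g.
Hypothesis g0 : forall x, (0 <= g x)%R.
Hypothesis weight : forall A, measurable A ->
  \int[mu]_x (g x * \1_A (phi x))%:E = c%:E * nu A.

Import HBNNSimple.

Lemma weighted_integral_nnsfun (h : {nnsfun T' >-> R}) :
  \int[mu]_x (g x * h (phi x))%:E = c%:E * \int[nu]_y (h y)%:E.
Proof.
have yind0 y z : (0 <= y * \1_(h @^-1` [set y]) z)%R.
  by have := nnfun_muleindic_ge0 h y z; rewrite -EFinM lee_fin.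
have mind (y : R) : measurable_fun setT
    (fun x => g x * \1_(h @^-1` [set y]) (phi x) : R)%R.
  apply: measurable_funM => //.
  by apply: measurableT_comp => //; exact: measurable_indic.
transitivity (\int[mu]_x \sum_(y \in range h)
    (g x * (y * \1_(h @^-1` [set y]) (phi x)))%:E).
  apply: eq_integral => x _.
  rewrite fsumEFin //; congr EFin.
  by rewrite [X in (_ * X)%R]fimfunE !fsbig_finite//= big_distrr.
rewrite ge0_integral_fsum//; last 2 first.
- move=> y; apply/measurable_EFinP.
  under eq_fun do rewrite mulrCA.
  exact: measurable_funM.
- by move=> y x _; rewrite lee_fin mulr_ge0.
under [in RHS]eq_integral do rewrite fimfunE -fsumEFin//.
rewrite [in RHS]ge0_integral_fsum//; last 2 first.
- move=> y; apply/measurable_EFinP; apply: measurable_funM => //.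
- by move=> y x _; rewrite lee_fin.
rewrite ge0_mule_fsumr; last first.
  by move=> y; apply: integral_ge0 => x _; rewrite lee_fin.
apply: eq_fsbigr => y; rewrite inE => -[z _ <-{y}].
under eq_integral do rewrite mulrCA EFinM.
rewrite ge0_integralZl_EFin//; last 2 first.
- by move=> x _; rewrite lee_fin mulr_ge0// indicE.
- exact/measurable_EFinP.
under [in RHS]eq_integral do rewrite EFinM.
rewrite ge0_integralZl_EFin//; last exact/measurable_EFinP.
by rewrite integral_indic// setIT weight// muleCA.
Qed.

(** The hypothesis [weight] is the case of indicators; linearity extends it to simple functions, and
    monotone convergence to nonnegative measurable ones. It serves three purposes below: splitting
    off one factor of an independent product ([g] is the product of the others), Gaussian densities
    ([phi] is the identity) and transport from pairs to complex numbers ([g] is 1). *)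
Lemma weighted_integral (f : T' -> \bar R) :
  measurable_fun setT f -> (forall y, 0 <= f y) ->
  \int[mu]_x ((g x)%:E * f (phi x)) = c%:E * \int[nu]_y f y.
Proof.
move=> mf f0; pose h := nnsfun_approx measurableT mf.
have cvh y : EFin \o h ^~ y @ \oo --> f y by exact: cvg_nnsfun_approx.
have -> : \int[mu]_x ((g x)%:E * f (phi x)) =
    limn (fun n => \int[mu]_x (g x * h n (phi x))%:E).
  rewrite -monotone_convergence//.
  - apply: eq_integral => x _; apply/esym/cvg_lim => //.
    under eq_fun do rewrite EFinM.
    by apply: cvgeZl => //; exact: cvh.
  - move=> n; apply/measurable_EFinP; apply: measurable_funM => //.
    exact: measurableT_comp.
  - by move=> n x _; rewrite lee_fin mulr_ge0.
  - move=> x _ a b ab; rewrite lee_fin ler_wpM2l//.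
    exact/lefP/nd_nnsfun_approx.
under eq_fun do rewrite weighted_integral_nnsfun.
apply/cvg_lim => //; apply: cvgeZl => //.
rewrite [X in _ --> X](_ : _ = \int[nu]_y limn (EFin \o h ^~ y)); last first.
  by apply: eq_integral => y _; apply/esym/cvg_lim.
apply: cvg_monotone_convergence => //.
- by move=> n; apply/measurable_EFinP.
- by move=> n x _; rewrite lee_fin.
- by move=> x _ a b ab; rewrite lee_fin; exact/lefP/nd_nnsfun_approx.
Qed.

End weighted_integral.

(** * Expectation of a product of functions of independent variables *)

Section expectation_of_products.
Local Open Scope ereal_scope.
Context d d' (T : measurableType d) (T' : measurableType d') (R : realType).
Variables (P : probability T R) (I : finType) (X : I -> {RV P >-> T'}).
Hypothesis indepX : mutually_independent X.

Let measurable_preimage i (A : set T') : measurable A ->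
  measurable (X i @^-1` A).
Proof.
by move=> mA; rewrite -[X in measurable X]setTI; exact: measurable_funP.
Qed.

Let expectation_prod_indic (A : I -> set T') : (forall i, measurable (A i)) ->
  \int[P]_t (\prod_i \1_(A i) (X i t))%:E = \prod_i P (X i @^-1` A i).
Proof.
move=> mA.
have := @indepX [set: I]%SET A (fun i _ => mA i).
rewrite [in X in _ = X](eq_bigl xpredT); last by move=> i; rewrite inE.
move=> <-; set B := \bigcap_(_ in _) _.
have BE t : B t = (forall i, A i (X i t)).
  apply/propext; split=> [tB i|tA i _]; last exact: tA.
  by apply: tB => /=; rewrite inE.
have mB : measurable B.
  by apply: fin_bigcap_measurable => // i _; exact: measurable_preimage.
transitivity (\int[P]_t (\1_B t)%:E); last by rewrite integral_indic// setIT.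
apply: eq_integral => t _; congr EFin; rewrite indicE.
have [tB|tB] := boolP (t \in B).
  rewrite big1// => i _; rewrite indicE mem_set//.
  by move: tB; rewrite inE BE; exact.
have : exists i, ~ A i (X i t).
  by apply/existsNP => tA; move/negP: tB; apply; rewrite inE BE.
by case=> i tAi; rewrite (bigD1 i)//= indicE memNset// mul0r.
Qed.

Lemma expectation_prod (F : I -> T' -> R) (e : I -> R) :
  (forall i, measurable_fun setT (F i)) -> (forall i y, (0 <= F i y)%R) ->
  (forall i, \int[P]_t (F i (X i t))%:E = (e i)%:E) ->
  \int[P]_t (\prod_i F i (X i t))%:E = (\prod_i e i)%:E.
Proof.
(* Indicators are replaced by general functions one index at a time: [s] lists
   the indices where [F] need not be an indicator. *)
have gen (s : seq I) : forall (F : I -> T' -> R) (e : I -> R),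
  (forall i, measurable_fun setT (F i)) -> (forall i y, (0 <= F i y)%R) ->
  (forall i, i \notin s -> exists2 A, measurable A & F i = \1_A) ->
  (forall i, \int[P]_t (F i (X i t))%:E = (e i)%:E) ->
  \int[P]_t (\prod_i F i (X i t))%:E = (\prod_i e i)%:E; last first.
  move=> mF F0 eF; apply: (gen (enum I)) => // i.
  by rewrite mem_enum.
elim: s => [|j s ih] {}F {}e mF F0 indF eF.
  have /choice[A AP] : forall i, exists A, measurable A /\ F i = \1_A.
    by move=> i; have [//|A mA FA] := indF i; exists A.
  under eq_integral => t _.
    under eq_bigr do rewrite (AP _).2.
    over.
  rewrite expectation_prod_indic; last by move=> i; exact: (AP i).1.
  rewrite (big_morph EFin EFinM erefl); apply: eq_bigr => i _.
  rewrite -eF (AP i).2 (@integral_indic _ _ _ P setT _ (X i @^-1` A i)) ?setIT//.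
  by apply: measurable_preimage; exact: (AP i).1.
have e0 i : (0 <= e i)%R.
  by rewrite -lee_fin -eF; apply: integral_ge0 => t _; rewrite lee_fin.
have bigj F' t : (\prod_i F' i (X i t) =
    (\prod_(i | i != j) F' i (X i t)) * F' j (X j t) :> R)%R.
  by rewrite (bigD1 j)//= mulrC.
transitivity (\int[P]_t ((\prod_(i | i != j) F i (X i t))%:E *
    (F j (X j t))%:E)).
  by apply: eq_integral => t _; rewrite bigj EFinM.
rewrite (weighted_integral (nu := distribution P (X j)) (phi := X j)
  (c := (\prod_(i | i != j) e i)%R) _ _ _ _ (f := EFin \o F j)); last 6 first.
- exact: measurable_funPT.
- rewrite (_ : (fun t => _) =
    (fun t => \prod_(i <- [seq i <- index_enum I | i != j]) F i (X i t))%R).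
    by apply: measurable_prod => i _; exact: measurableT_comp.
  by apply/funext => t; rewrite big_filter.
- by move=> t; exact: prodr_ge0.
- move=> A mA.
  (* Replacing the factor at [j] by an indicator leaves one index fewer to treat, so the induction
     hypothesis applies to [F'] and yields the [weight] hypothesis, with the product of the other
     expectations as constant. *)
  pose F' i := if i == j then \1_A : T' -> R else F i.
  pose e' i := if i == j then fine (P (X j @^-1` A)) else e i.
  have PjA : (fine (P (X j @^-1` A)))%:E = P (X j @^-1` A).
    by rewrite fineK// fin_num_measure//; exact: measurable_preimage.
  have e'E : (\prod_i e' i)%:E =
      (\prod_(i | i != j) e i)%:E * P (X j @^-1` A).
    rewrite (bigD1 j)//= {1}/e' eqxx mulrC EFinM PjA; congr (_%:E * _).
    by apply: eq_bigr => i /negbTE ij; rewrite /e' ij.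
  rewrite /distribution /pushforward/= -e'E -(ih F').
  + apply: eq_integral => t _; rewrite bigj {2}/F' eqxx.
    by congr (_ * _)%:E; apply: eq_bigr => i /negbTE ij; rewrite /F' ij.
  + by move=> i; rewrite /F'; case: ifP => // _; exact: measurable_indic.
  + by move=> i y; rewrite /F'; case: ifP => // _; rewrite indicE.
  + move=> i si; rewrite /F'; case: ifPn => [_|ij]; first by exists A.
    by apply: indF; rewrite inE negb_or ij.
  + move=> i; rewrite /F' /e'; case: ifPn => [/eqP ->|//].
    rewrite PjA (@integral_indic _ _ _ P setT _ (X j @^-1` A)) ?setIT//.
    exact: measurable_preimage.
- exact/measurable_EFinP.
- by move=> y; rewrite lee_fin.
rewrite ge0_integral_distribution//=; last 2 first.
- exact/measurable_EFinP.
- by move=> y; rewrite lee_fin.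
by rewrite eF -EFinM [in RHS](bigD1 j)//= mulrC.
Qed.

End expectation_of_products.

(** * Laplace transforms of squared Gaussian moduli *)

Section gaussian.
Local Open Scope ereal_scope.
Context (R : realType).

Lemma integral_normal_prob (m sigma : R) (f : R -> \bar R) :
  measurable_fun setT f -> (forall x, 0 <= f x) ->
  \int[normal_prob m sigma]_x f x =
  \int[lebesgue_measure]_x ((normal_pdf m sigma x)%:E * f x).
Proof.
move=> mf f0; apply/esym.
rewrite (weighted_integral (nu := normal_prob m sigma) (phi := id)
  (c := 1%R) _ _ _ _ (f := f)) ?mul1e//.
- exact: measurable_normal_pdf.
- exact: normal_pdf_ge0.
- move=> A mA; rewrite mul1e /normal_prob [RHS]integral_mkcond.
  by apply: eq_integral => x _; rewrite epatch_indic EFinM.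
Qed.

(** With [u = 1 + 2 s sigma^2], the density times [exp (- s x^2)] is a constant multiple of the
    normal density of mean [m / u] and variance [sigma^2 / u], whose total mass is 1. *)
Lemma laplace_normal_sqr (m sigma s : R) : (0 < sigma)%R -> (0 <= s)%R ->
  \int[normal_prob m sigma]_x (expR (- (s * x ^+ 2)))%:E =
  ((Num.sqrt (1 + s * (sigma ^+ 2 *+ 2)))^-1 *
   expR (- (s * m ^+ 2 / (1 + s * (sigma ^+ 2 *+ 2)))))%:E.
Proof.
move=> sigma0 s0; set u := (1 + _)%R.
have u0 : (0 < u)%R.
  by rewrite /u ltr_wpDr// mulr_ge0// mulrn_wge0// sqr_ge0.
have su0 : (0 < Num.sqrt u)%R by rewrite sqrtr_gt0.
rewrite integral_normal_prob; last 2 first.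
- apply/measurable_EFinP; apply: measurableT_comp => //.
  apply: measurableT_comp => //; apply: measurable_funM => //.
- by move=> x; rewrite lee_fin expR_ge0.
set C := (_ * expR _)%R.
(* Completing the square. *)
have pdfE x : (normal_pdf m sigma x * expR (- (s * x ^+ 2)) =
    C * normal_pdf (m / u) (sigma / Num.sqrt u) x)%R.
  rewrite !normal_pdfE ?gt_eqF ?divr_gt0// /normal_peak /normal_fun.
  have -> : ((sigma / Num.sqrt u) ^+ 2 * pi *+ 2 =
             u^-1 * (sigma ^+ 2 * pi *+ 2))%R.
    by rewrite expr_div_n sqr_sqrtr ?ltW//; field; rewrite gt_eqF.
  rewrite sqrtrM ?invr_ge0 ?ltW// sqrtrV ?ltW// invfM invrK.
  have expE : (expR (- (x - m) ^+ 2 / (sigma ^+ 2 *+ 2)) *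
      expR (- (s * x ^+ 2)) = expR (- (s * m ^+ 2 / u)) *
      expR (- (x - m / u) ^+ 2 / ((sigma / Num.sqrt u) ^+ 2 *+ 2)))%R.
    rewrite -!expRD; congr expR.
    rewrite expr_div_n sqr_sqrtr ?ltW// /u; field.
    by rewrite (gt_eqF sigma0) andbT mulr_natr gt_eqF.
  rewrite -mulrA expE /C.
  have : Num.sqrt (sigma ^+ 2 * pi *+ 2) != 0%R.
    by rewrite gt_eqF// sqrtr_gt0 mulrn_wgt0// mulr_gt0 ?pi_gt0 ?exprn_gt0.
  move: (Num.sqrt (sigma ^+ 2 * pi *+ 2)) => p p0.
  by field; rewrite p0 gt_eqF.
under eq_integral do rewrite -EFinM pdfE EFinM.
rewrite ge0_integralZl_EFin//.
- by rewrite integral_normal_pdf mule1.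
- by move=> x _; rewrite lee_fin normal_pdf_ge0.
- by apply/measurable_EFinP; exact: measurable_normal_pdf.
- by rewrite /C mulr_ge0 ?expR_ge0// invr_ge0 ltW.
Qed.

Lemma measurable_pair_of_complex : measurable_fun setT (@pair_of_complex R).
Proof. by move=> _ B mB; rewrite setTI; exists B => //; rewrite setTI. Qed.

Lemma measurable_complex_of_pair : measurable_fun setT (@complex_of_pair R).
Proof.
move=> _ _ [B mB <-]; rewrite !setTI.
rewrite (_ : _ @^-1` _ = B)//.
by apply/seteqP; split => -[x y].
Qed.

Lemma normc_sqr (z : R[i]) :
  (Normc.normc z ^+ 2 = (pair_of_complex z).1 ^+ 2 + (pair_of_complex z).2 ^+ 2)%R.
Proof. by case: z => a b /=; rewrite sqr_sqrtr// addr_ge0 ?sqr_ge0. Qed.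

Lemma measurable_normc_sqr :
  measurable_fun setT (fun z : R[i] => Normc.normc z ^+ 2)%R.
Proof.
under eq_fun do rewrite normc_sqr.
have mp := measurable_pair_of_complex.
by apply: measurable_funD; apply: measurable_funX;
  [exact: (measurableT_comp measurable_fst mp)|
   exact: (measurableT_comp measurable_snd mp)].
Qed.

(** By Tonelli the transform is the product of those of the real and imaginary parts. Each
    contributes a factor [1 / sqrt (1 + s v)]; the mean is real, so only the real part contributes
    an exponential. *)
Lemma laplace_complex_normal d (T : measurableType d) (P : probability T R)
    (X : {RV P >-> R[i]}) (kappa v s : R) : (0 < v)%R -> (0 <= s)%R ->
  has_law X (complex_normal_prob kappa%:C%C v) ->
  \int[P]_t (expR (- (s * Normc.normc (X t) ^+ 2)))%:E =
  ((1 + s * v)^-1 * expR (- (s * kappa ^+ 2 / (1 + s * v))))%:E.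
Proof.
move=> v0 s0 lawX.
pose sigma := Num.sqrt (v / 2).
have sigma0 : (0 < sigma)%R by rewrite sqrtr_gt0 divr_gt0.
have sigma2 : (sigma ^+ 2 *+ 2 = v)%R.
  by rewrite sqr_sqrtr ?divr_ge0 ?ltW//; field.
pose f (z : R[i]) := (expR (- (s * Normc.normc z ^+ 2)))%:E.
have mf : measurable_fun setT f.
  apply/measurable_EFinP; apply: measurableT_comp => //.
  apply: measurableT_comp => //; apply: measurable_funM => //.
  exact: measurable_normc_sqr.
have f0 z : 0 <= f z by rewrite lee_fin expR_ge0.
transitivity (\int[distribution P X]_z f z).
  by rewrite ge0_integral_distribution.
have mc := measurable_complex_of_pair.
(* [complex_normal_prob] is a bare set function, so the integral passes directly from the law of [X]
   to the product of normal laws, with weight 1. *)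
have -> : \int[distribution P X]_z f z =
    \int[(normal_prob kappa sigma \x normal_prob 0 sigma)%E]_xy
      f (complex_of_pair xy).
  rewrite -[LHS]mul1e -(weighted_integral
    (mu := (normal_prob kappa sigma \x normal_prob 0 sigma)%E)
    (phi := @complex_of_pair R) (g := cst 1%R) (c := 1%R) _ _ _ _ (f := f))//.
    by apply: eq_integral => xy _; rewrite mul1e.
  move=> A mA; rewrite mul1e.
  transitivity (\int[(normal_prob kappa sigma \x normal_prob 0 sigma)%E]_xy
      (\1_(@complex_of_pair R @^-1` A) xy)%:E).
    by apply: eq_integral => xy _; rewrite mul1r.
  have mcA : measurable (@complex_of_pair R @^-1` A).
    by rewrite -[X in measurable X]setTI; exact: mc.
  by rewrite integral_indic// setIT -[LHS](lawX A mA).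
rewrite fubini_tonelli1//=; last exact: (measurableT_comp mf mc).
pose g (x : R) := expR (- (s * x ^+ 2)).
have mg : measurable_fun setT (EFin \o g).
  apply/measurable_EFinP; apply: measurableT_comp => //.
  apply: measurableT_comp => //; apply: measurable_funM => //.
have fE x y : f (complex_of_pair (x, y)) = (g x)%:E * (g y)%:E.
  rewrite /f normc_sqr -EFinM -expRD/=; congr (expR _)%:E; ring.
transitivity (\int[normal_prob kappa sigma]_x
   ((g x)%:E * \int[normal_prob 0 sigma]_y (g y)%:E)).
  apply: eq_integral => x _; rewrite /fubini_F/=.
  under eq_integral do rewrite fE.
  by rewrite ge0_integralZl_EFin// ?expR_ge0// => y _; rewrite lee_fin expR_ge0.
rewrite !laplace_normal_sqr// sigma2.
under eq_integral do rewrite muleC.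
rewrite ge0_integralZl_EFin//; last by move=> x _; rewrite lee_fin expR_ge0.
rewrite laplace_normal_sqr// sigma2 -EFinM; congr EFin.
rewrite expr0n/= mulr0 mul0r oppr0 expR0 mulr1 mulrA -invfM -expr2 sqr_sqrtr//.
by rewrite addr_ge0// mulr_ge0// ltW.
Qed.

End gaussian.

(** * Concavity of the log-Laplace transform and its saddle point *)

Section rician_log_laplace.
Context (R : realType).
Implicit Types m v s x y : R.

(* [- log E exp (- s |H|^2)] for H ~ CN(kappa, v) with m = kappa^2. *)
Definition log_laplace m v s : R := ln (1 + s * v) + s * m / (1 + s * v).

Definition log_laplace_deriv m v s : R :=
  v / (1 + s * v) + m / (1 + s * v) ^+ 2.

Lemma ln_lt_sub1 x : 0 < x -> x != 1 -> ln x < x - 1.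
Proof.
move=> x0 x1; rewrite ltrBrDl.
by rewrite -[ltRHS]lnK ?posrE// expR_gt1Dx// ln_eq0.
Qed.

(** Strict concavity, obtained without differentiating. For the logarithm, [ln r < r - 1] is used at
    [r = q / p] and [r = p / q]. The rational term has chord slope exactly [m / (p q)], which lies
    between [m / q^2] and [m / p^2]. *)
Lemma log_laplace_chord m v x y : 0 <= m -> 0 < v -> 0 <= x -> x < y ->
  (y - x) * log_laplace_deriv m v y < log_laplace m v y - log_laplace m v x
    < (y - x) * log_laplace_deriv m v x.
Proof.
move=> m0 v0 x0 xy; rewrite /log_laplace /log_laplace_deriv.
set p := 1 + x * v; set q := 1 + y * v.
have p0 : 0 < p by rewrite /p ltr_wpDr// mulr_ge0// ltW.
have pq : p < q by rewrite ltrD2l ltr_pM2r.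
have q0 : 0 < q := lt_trans p0 pq.
have rat_term : y * m / q - x * m / p = (y - x) * m / (p * q).
  by rewrite /p /q; field; rewrite gt_eqF//= gt_eqF.
have lnqp : ln q - ln p < (y - x) * v / p.
  rewrite -ln_div ?posrE//.
  have -> : (y - x) * v / p = q / p - 1.
    by rewrite /p /q; field; rewrite gt_eqF.
  apply: ln_lt_sub1; first by rewrite divr_gt0.
  by rewrite gt_eqF// ltr_pdivlMr// mul1r.
have lnpq : ln p - ln q < - ((y - x) * v / q).
  rewrite -ln_div ?posrE//.
  have -> : - ((y - x) * v / q) = p / q - 1.
    by rewrite /p /q; field; rewrite gt_eqF.
  apply: ln_lt_sub1; first by rewrite divr_gt0.
  by rewrite lt_eqF// ltr_pdivrMr// mul1r.
have mpq0 : 0 <= (y - x) * m by rewrite mulr_ge0// subr_ge0 ltW.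
have le1 : (y - x) * m / (p * q) <= (y - x) * (m / p ^+ 2).
  rewrite mulrA ler_wpM2l// lef_pV2 ?posrE ?mulr_gt0 ?exprn_gt0//.
  by rewrite expr2 ler_pM2l// ltW.
have le2 : (y - x) * (m / q ^+ 2) <= (y - x) * m / (p * q).
  rewrite mulrA ler_wpM2l// lef_pV2 ?posrE ?mulr_gt0 ?exprn_gt0//.
  by rewrite expr2 ler_pM2r// ltW.
have -> : ln q + y * m / q - (ln p + x * m / p) =
    ln q - ln p + (y - x) * m / (p * q) by rewrite -rat_term; ring.
move: lnqp lnpq le1 le2; rewrite !mulrDr -![(y - x) * v / _]mulrA.
move: (ln q) (ln p) ((y - x) * (v / p)) ((y - x) * (v / q))
  ((y - x) * (m / p ^+ 2)) ((y - x) * (m / q ^+ 2)) ((y - x) * m / (p * q)).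
by move=> ? ? ? ? ? ? ? ? ? ? ?; apply/andP; split; lra.
Qed.

Lemma continuous_log_laplace m v s : 0 < v -> 0 <= s ->
  {for s, continuous (log_laplace m v)}.
Proof.
move=> v0 s0; have p0 : 0 < 1 + s * v by rewrite ltr_wpDr// mulr_ge0// ltW.
have cv1 : {for s, continuous (fun x => 1 + x * v)}.
  by apply: cvgD; [exact: cvg_cst|apply: cvgMr_tmp; exact: cvg_id].
apply: cvgD; first by apply: continuous_comp cv1 _; exact: continuous_ln.
by apply: cvgM; [apply: cvgMr_tmp; exact: cvg_id|apply: cvgV => //; rewrite gt_eqF].
Qed.

Lemma continuous_log_laplace_deriv m v s : 0 < v -> 0 <= s ->
  {for s, continuous (log_laplace_deriv m v)}.
Proof.
move=> v0 s0; have p0 : 0 < 1 + s * v by rewrite ltr_wpDr// mulr_ge0// ltW.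
have cv1 : {for s, continuous (fun x => 1 + x * v)}.
  by apply: cvgD; [exact: cvg_cst|apply: cvgMr_tmp; exact: cvg_id].
apply: cvgD; apply: cvgM; try exact: cvg_cst; apply: cvgV.
- by rewrite gt_eqF.
- exact: cv1.
- by rewrite gt_eqF// exprn_gt0.
- rewrite expr2; under eq_fun do rewrite expr2; exact: cvgM.
Qed.

(** In the variable [u = 1 + s v] the saddle equation reads [u^2 = eta (v u + m)], and
    [v eta (1 + S) / 2] is its positive root. *)
Lemma rician_saddle_point (m v eta : R) : 0 <= m -> 0 < v -> m + v = 1 ->
  1 <= eta ->
  exists s : R, [/\ 0 <= s, log_laplace_deriv m v s = eta^-1 &
    log_laplace m v s - s / eta =
    (v * eta)^-1 + m / v - Num.sqrt (1 + 4 * m / (v ^+ 2 * eta))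
    + ln (v * eta / 2) + ln (1 + Num.sqrt (1 + 4 * m / (v ^+ 2 * eta)))].
Proof.
move=> m0 v0 mv eta1; have eta0 : 0 < eta by exact: lt_le_trans eta1.
have ve0 : 0 < v * eta by rewrite mulr_gt0.
set D := 1 + _; set S := Num.sqrt D.
have D0 : 0 <= D by rewrite /D addr_ge0// !mulr_ge0// invr_ge0 ltW// mulr_gt0 ?exprn_gt0.
have S0 : 0 <= S by rewrite sqrtr_ge0.
have SS : (v * eta * S) ^+ 2 = (v * eta) ^+ 2 + 4 * m * eta.
  by rewrite exprMn sqr_sqrtr// /D; field; rewrite !gt_eqF.
pose u := v * eta / 2 * (1 + S).
have uu : u ^+ 2 = eta * (v * u + m).
  have -> : u ^+ 2 = (v * eta / 2) ^+ 2 * (1 + 2 * S) + (v * eta * S) ^+ 2 / 4.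
    by rewrite /u; field.
  by rewrite SS /u; field.
(* This is [s >= 0]. When [2 - v eta] is positive, squaring reduces the claim to [1 <= (m + v) eta],
   that is [1 <= eta]. *)
have u1 : 1 <= u.
  suff : 2 - v * eta <= v * eta * S by rewrite /u; lra.
  have [le0|gt0] := leP (2 - v * eta) 0.
    by rewrite (le_trans le0)// mulr_ge0// ltW.
  have veS0 : 0 <= v * eta * S by rewrite mulr_ge0// ltW.
  rewrite -ler_sqr ?nnegrE//; last exact: ltW.
  rewrite SS.
  have : 1 <= (m + v) * eta by rewrite mv mul1r.
  rewrite !expr2; nra.
have u0 : 0 < u by lra.
(* Eliminating [m] through the quadratic equation turns the remaining goals into rational identities
   in [u], [v] and [eta], up to the logarithms. *)
have mE : m = u ^+ 2 / eta - v * u by rewrite uu; field; rewrite gt_eqF.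
exists ((u - 1) / v).
have uE : 1 + (u - 1) / v * v = u by field; rewrite gt_eqF.
rewrite /log_laplace_deriv /log_laplace uE; split.
- by rewrite divr_ge0 ?subr_ge0// ltW.
- by rewrite mE; field; rewrite !gt_eqF.
- have -> : ln u = ln (v * eta / 2) + ln (1 + S).
    by rewrite -lnM ?posrE ?divr_gt0//; lra.
  have SE : S = 2 * u / (v * eta) - 1.
    by rewrite /u; field; rewrite !gt_eqF.
  move: (ln (v * eta / 2)) (ln (1 + S)) => l1 l2.
  by rewrite [in RHS]SE mE; field; rewrite !gt_eqF.
Qed.

End rician_log_laplace.

(** * Auxiliary facts on integrals and on the logarithm *)

Lemma ge0_integral_axpy d (T : measurableType d) (R : realType)
    (mu : {measure set T -> \bar R}) (a : R) (f g : T -> R) :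
  0 <= a -> measurable_fun setT f -> measurable_fun setT g ->
  (forall x, 0 <= f x) -> (forall x, 0 <= g x) ->
  (\int[mu]_x (a * f x + g x)%:E =
   a%:E * \int[mu]_x (f x)%:E + \int[mu]_x (g x)%:E)%E.
Proof.
move=> a0 mf mg f0 g0; under eq_integral do rewrite EFinD EFinM.
rewrite ge0_integralD//=.
- rewrite ge0_integralZl_EFin//; last exact/measurable_EFinP.
  by move=> x _; rewrite lee_fin.
- by move=> x _; rewrite mule_ge0 ?lee_fin.
- by apply: measurable_funeM; exact/measurable_EFinP.
- by move=> x _; rewrite lee_fin.
- exact/measurable_EFinP.
Qed.

(** This is [ln (1 + y) <= y] at [y = - x / (1 + x)], where [1 + y] is the inverse of [1 + x]. *)
Lemma ln1D_ge (R : realType) (x : R) : 0 <= x -> x / (1 + x) <= ln (1 + x).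
Proof.
move=> x0; have x1 : 0 < 1 + x by rewrite ltr_wpDr.
have a1 : -1 < - (x / (1 + x)) by rewrite ltrN2 ltr_pdivrMr// mul1r ltrDr.
have := le_ln1Dx a1.
have -> : 1 + - (x / (1 + x)) = (1 + x)^-1 by field; rewrite gt_eqF.
by rewrite lnV ?posrE// lerN2.
Qed.

(** * Bounds on the outage probability for a fixed number of channels *)

Section outage_bounds.
Context (R : realType) d (T : measurableType d) (P : probability T R).
Variables (H : forall K : nat, 'I_K -> {RV P >-> R[i]}) (kappa v rho eta : R).
Arguments H : clear implicits.
Hypotheses (v0 : 0 < v) (rho0 : 0 < rho).
Hypothesis H_indep : forall K, mutually_independent (H K).
Hypothesis H_law : forall K (k : 'I_K),
  has_law (H K k) (complex_normal_prob kappa%:C v).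

Let m := kappa ^+ 2.
Let gain K (k : 'I_K) (t : T) : R := Normc.normc (H K k t) ^+ 2.
Let total_gain K (t : T) : R := \sum_(k < K) gain k t.
Let outage K := [set t | achievable_rate H K rho t <= rho / eta].

Let gain_ge0 K (k : 'I_K) t : 0 <= gain k t.
Proof. exact: sqr_ge0. Qed.

Let measurable_gain K (k : 'I_K) : measurable_fun setT (gain k).
Proof.
by have := measurableT_comp (@measurable_normc_sqr R) (measurable_funPT (H K k)).
Qed.

Let measurable_total_gain K : measurable_fun setT (total_gain K).
Proof. by apply: measurable_sum => k; exact: measurable_gain. Qed.

Lemma measurable_outage K :
  measurable [set t | achievable_rate H K rho t <= rho / eta].
Proof.
have mA : measurable_fun setT (achievable_rate H K rho).
  apply: measurable_sum => k; apply: measurableT_comp => //.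
  apply: measurable_funD => //; apply: measurable_funM => //.
  exact: measurable_gain.
rewrite -[X in measurable X]setTI.
exact: (measurable_fun_le measurableT mA (measurable_cst _)).
Qed.

Let laplace_gain K (k : 'I_K) (s : R) : 0 <= s ->
  (\int[P]_t (expR (- (s * gain k t)))%:E)%E = (expR (- log_laplace m v s))%:E.
Proof.
move=> s0; rewrite (laplace_complex_normal v0 s0 (@H_law K k)).
have p0 : 0 < 1 + s * v by rewrite ltr_wpDr// mulr_ge0// ltW.
by rewrite /log_laplace opprD expRD -lnV ?posrE// lnK ?posrE ?invr_gt0.
Qed.

Let laplace_total_gain K (s : R) : 0 <= s ->
  (\int[P]_t (expR (- (s * total_gain K t)))%:E)%E =
  (expR (- (K%:R * log_laplace m v s)))%:E.
Proof.
move=> s0.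
pose F (k : 'I_K) (z : R[i]) := expR (- (s * Normc.normc z ^+ 2)).
rewrite (eq_integral (fun t => (\prod_(k < K) F k (H K k t))%:E)); last first.
  move=> t _; congr EFin.
  rewrite /total_gain mulr_sumr -sumrN expR_sum; exact: eq_bigr.
rewrite (expectation_prod (@H_indep K) (e := fun=> expR (- log_laplace m v s))).
- by rewrite prodr_const card_ord -expRM_natl mulrN.
- move=> k; apply: measurableT_comp => //; apply: measurableT_comp => //.
  by apply: measurable_funM => //; exact: measurable_normc_sqr.
- by move=> k z; exact: expR_ge0.
- by move=> k; exact: laplace_gain.
Qed.

Let outage_fin K : P (outage K) = (fine (P (outage K)))%:E.
Proof. by rewrite fineK// fin_num_measure//; exact: measurable_outage. Qed.

(* Exponential tilting without a change of measure: with [S] the total gain,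
   [exp (- s S)] is split according to [S > K / eta], [S < K c] or neither; only
   the last case lies in the outage event, the others are Chernoff-bounded. *)
Lemma outage_lower K (s0 s s2 c : R) : (0 < K)%N ->
  0 <= s0 -> s0 <= s -> s <= s2 ->
  expR (- (K%:R * log_laplace m v s)) <=
    expR (- (K%:R * (s * c))) * fine (outage_probability H K rho (rho / eta)) +
    expR (- (K%:R * (log_laplace m v s0 + (s - s0) / eta))) +
    expR (- (K%:R * (log_laplace m v s2 - (s2 - s) * c))).
Proof.
rewrite -[outage_probability _ _ _ _]/(P (outage K)) => K0 s00 s0s ss2.
have K0' : 0 < K%:R :> R by rewrite ltr0n.
have s_ge0 := le_trans s00 s0s; have s2_ge0 := le_trans s_ge0 ss2.
(* Consequently a total gain of at most [K / eta] forces an outage. *)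
have rate_le t : achievable_rate H K rho t <= rho / K%:R * total_gain K t.
  rewrite /achievable_rate mulr_sumr; apply: ler_sum => k _.
  apply: le_ln1Dx; apply: (@lt_le_trans _ _ 0) => //.
  by rewrite mulr_ge0 ?gain_ge0// divr_ge0// ltW.
have mexp (s' : R) :
    measurable_fun setT (fun t => expR (- (s' * total_gain K t))).
  apply: measurableT_comp => //; apply: measurableT_comp => //.
  by apply: measurable_funM.
(* Each constant dominates on one range of the total gain [S]: [C1] on [S >= K c], [C2] on
   [S > K / eta] since [(s - s0) (S - K / eta) >= 0], and [C3] on [S < K c] since
   [(s2 - s) (K c - S) >= 0]. *)
pose C1 := expR (- (K%:R * (s * c))).
pose C2 := expR (- (K%:R * ((s - s0) / eta))).
pose C3 := expR (K%:R * ((s2 - s) * c)).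
have ptw t : expR (- (s * total_gain K t)) <=
    C1 * \1_(outage K) t + C2 * expR (- (s0 * total_gain K t)) +
    C3 * expR (- (s2 * total_gain K t)).
  have C10 : 0 <= C1 * \1_(outage K) t by rewrite mulr_ge0 ?expR_ge0// indicE.
  have C20 : 0 <= C2 * expR (- (s0 * total_gain K t)).
    by rewrite mulr_ge0 ?expR_ge0.
  have C30 : 0 <= C3 * expR (- (s2 * total_gain K t)).
    by rewrite mulr_ge0 ?expR_ge0.
  have [hi|lo] := ltP (K%:R / eta) (total_gain K t).
    rewrite -addrA addrCA ler_wpDr ?addr_ge0// -expRD ler_expR.
    nra.
  have [lo'|hi'] := ltP (total_gain K t) (K%:R * c).
    rewrite ler_wpDl ?addr_ge0// -expRD ler_expR.
    nra.
  rewrite -addrA ler_wpDr ?addr_ge0// indicE mem_set; last first.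
    rewrite /outage/=; apply: (le_trans (rate_le t)).
    have -> : rho / eta = rho / K%:R * (K%:R / eta).
      by rewrite mulrA divfK// gt_eqF.
    by rewrite ler_wpM2l// divr_ge0// ltW.
  rewrite /= mulr1 ler_expR.
  nra.
have mo : measurable_fun setT (\1_(outage K) : T -> R).
  by apply: measurable_indic; exact: measurable_outage.
have ind0 t : 0 <= \1_(outage K) t :> R by rewrite indicE.
have mCexp (C s' : R) :
    measurable_fun setT (fun t => C * expR (- (s' * total_gain K t))).
  exact: measurable_funM.
have Cexp0 (s' : R) (C : R) t : 0 <= expR C * expR (- (s' * total_gain K t)).
  by rewrite mulr_ge0 ?expR_ge0.
pose h t := C1 * \1_(outage K) t + (C2 * expR (- (s0 * total_gain K t)) +
    C3 * expR (- (s2 * total_gain K t))).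
have int_h : (\int[P]_t (h t)%:E = (C1 * fine (P (outage K)) +
    (C2 * expR (- (K%:R * log_laplace m v s0)) +
     C3 * expR (- (K%:R * log_laplace m v s2))))%:E)%E.
  rewrite ge0_integral_axpy; first last.
  - by move=> t; apply: addr_ge0; exact: Cexp0.
  - exact: ind0.
  - exact: measurable_funD.
  - exact: mo.
  - exact: expR_ge0.
  rewrite integral_indic ?setIT//; last exact: measurable_outage.
  rewrite ge0_integral_axpy; first last.
  - exact: Cexp0.
  - by move=> t; exact: expR_ge0.
  - exact: mCexp.
  - exact: mexp.
  - exact: expR_ge0.
  have -> : (\int[P]_t (C3 * expR (- (s2 * total_gain K t)))%:E =
      (C3 * expR (- (K%:R * log_laplace m v s2)))%:E)%E.
    under eq_integral do rewrite EFinM.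
    rewrite ge0_integralZl_EFin//; first last.
    - exact: expR_ge0.
    - exact/measurable_EFinP.
    by rewrite laplace_total_gain.
  by rewrite laplace_total_gain// !EFinD !EFinM -outage_fin.
have mh : measurable_fun setT h.
  by apply: measurable_funD; [exact: measurable_funM|exact: measurable_funD].
have : (\int[P]_t (expR (- (s * total_gain K t)))%:E <= \int[P]_t (h t)%:E)%E.
  apply: ge0_le_integral => //.
  - exact/measurable_EFinP.
  - exact/measurable_EFinP.
  - by move=> t _; rewrite lee_fin /h addrA.
rewrite laplace_total_gain// int_h lee_fin addrA /C1 /C2 /C3 -!expRD.
move/le_trans; apply.
apply: lerD; first apply: lerD => //.
  by rewrite ler_expR; lra.
by rewrite ler_expR; lra.
Qed.

(* Chernoff at parameter [s K / rho]; each factor is compared with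
   [exp (- s' |H_k|^2)] when [|H_k|^2 <= A], using [x / (1 + x) <= ln (1 + x)],
   and with [exp (- s' A)] otherwise. *)
Lemma outage_upper K (s A s' : R) : (0 < K)%N -> 0 < s -> 0 < A ->
  s' = s / (1 + rho * A / K%:R) ->
  fine (outage_probability H K rho (rho / eta)) <= expR (K%:R * (s / eta)) *
    (expR (- log_laplace m v s') + expR (- (s' * A))) ^+ K.
Proof.
rewrite -[outage_probability _ _ _ _]/(P (outage K)) => K0 s0 A0 s'E.
have K0' : 0 < K%:R :> R by rewrite ltr0n.
have rK0 : 0 < rho / K%:R by rewrite divr_gt0.
have den0 (w : R) : 0 <= w -> 0 < 1 + rho * w / K%:R.
  by move=> w0; rewrite ltr_wpDr// !mulr_ge0// ?invr_ge0 ltW.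
have s'0 : 0 <= s' by rewrite s'E divr_ge0 ?ltW// den0// ltW.
(* The product of these factors over the channels is [exp (- (s K / rho) R)], with [R] the
   achievable rate. *)
pose F (k : 'I_K) (z : R[i]) :=
  expR (- (s * (K%:R / rho) * ln (1 + rho / K%:R * Normc.normc z ^+ 2))).
have mF k : measurable_fun setT (F k).
  apply: measurableT_comp => //; apply: measurableT_comp => //.
  apply: measurable_funM => //; apply: measurableT_comp => //.
  apply: measurable_funD => //; apply: measurable_funM => //.
  exact: measurable_normc_sqr.
have F0 k z : 0 <= F k z by exact: expR_ge0.
set b := expR (- log_laplace m v s') + _.
(* The factor 1 gives the bound the shape that [ge0_integral_axpy] expects. *)
have F_le k z : F k z <= 1 * expR (- (s' * Normc.normc z ^+ 2)) +
    expR (- (s' * A)).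
  rewrite /F; have := sqr_ge0 (Normc.normc z).
  move: (Normc.normc z ^+ 2) => w w0.
  have step : s * w / (1 + rho * w / K%:R) <=
      s * (K%:R / rho) * ln (1 + rho / K%:R * w).
    have -> : s * w / (1 + rho * w / K%:R) =
        s * (K%:R / rho) * (rho / K%:R * w / (1 + rho / K%:R * w)).
      rewrite [rho / K%:R * w]mulrAC; field.
      by rewrite !gt_eqF// ltr_wpDr// mulr_ge0// ltW.
    rewrite ler_wpM2l//; first by rewrite mulr_ge0 ?divr_ge0// ltW.
    by apply: ln1D_ge; rewrite mulr_ge0// ltW.
  have [wA|Aw] := leP w A.
    rewrite mul1r ler_wpDr ?expR_ge0// ler_expR lerN2; apply: (le_trans _ step).
    rewrite s'E mulrAC ler_wpM2l ?mulr_ge0 ?(ltW s0)//.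
    rewrite lef_pV2 ?posrE ?den0 ?(ltW A0)// lerD2l ler_pM2r ?invr_gt0//.
    by rewrite ler_pM2l.
  (* Beyond [A], monotonicity of [w / (1 + rho w / K)] bounds the exponent by its value at [A],
     which is [s' A]. *)
  rewrite mul1r ler_wpDl ?expR_ge0// ler_expR lerN2; apply: (le_trans _ step).
  rewrite s'E mulrAC ler_pdivrMr ?den0 ?(ltW A0)//.
  rewrite mulrAC ler_pdivlMr ?den0//.
  have : s * A <= s * w by rewrite ler_pM2l// ltW.
  lra.
pose e k := fine (\int[P]_t (F k (H K k t))%:E)%E.
have int_F k : (0 <= \int[P]_t (F k (H K k t))%:E <= b%:E)%E.
  apply/andP; split; first by apply: integral_ge0 => t _; rewrite lee_fin.
  have <- : (\int[P]_t (1 * expR (- (s' * gain k t)) +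
      expR (- (s' * A)))%:E = b%:E)%E.
    rewrite ge0_integral_axpy//; last first.
      apply: measurableT_comp => //; apply: measurableT_comp => //.
      exact: measurable_funM.
    by rewrite laplace_gain// integral_cst//= probability_setT mule1 mul1e.
  apply: ge0_le_integral => //.
  - by move=> t _; rewrite lee_fin.
  - by apply/measurable_EFinP; exact: measurableT_comp.
  - apply/measurable_EFinP; apply: measurable_funD => //.
    apply: measurable_funM => //; apply: measurableT_comp => //.
    apply: measurableT_comp => //; exact: measurable_funM.
  - by move=> t _; rewrite lee_fin F_le.
have eE k : (\int[P]_t (F k (H K k t))%:E = (e k)%:E)%E.
  have /andP[i0 ib] := int_F k.
  by rewrite /e fineK// ge0_fin_numE// (le_lt_trans ib)// ltry.
have e_le k : 0 <= e k <= b.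
  by have := int_F k; rewrite eE !lee_fin.
have prod_e : \prod_k e k <= b ^+ K.
  have -> : b ^+ K = \prod_(k < K) b by rewrite prodr_const card_ord.
  by apply: ler_prod => k _; exact: e_le.
apply: (@le_trans _ _ (expR (K%:R * (s / eta)) * \prod_k e k)); last first.
  by rewrite ler_wpM2l// expR_ge0.
rewrite -lee_fin -outage_fin EFinM.
rewrite -(expectation_prod (@H_indep K) mF F0 eE).
have mprod : measurable_fun setT (fun t => \prod_k F k (H K k t)).
  by apply: measurable_prod => k _; exact: measurableT_comp.
rewrite -ge0_integralZl_EFin//; first last.
- exact/measurable_EFinP.
- by move=> t _; rewrite lee_fin prodr_ge0.
have mo : measurable_fun setT (\1_(outage K) : T -> R).
  by apply: measurable_indic; exact: measurable_outage.
rewrite (_ : P (outage K) = \int[P]_t (\1_(outage K) t)%:E)%E; last first.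
  by rewrite integral_indic ?setIT//; exact: measurable_outage.
apply: ge0_le_integral => //.
- exact/measurable_EFinP.
- by apply: measurable_funeM; exact/measurable_EFinP.
move=> t _; rewrite -EFinM lee_fin indicE.
have [|_] := boolP (t \in outage K); last first.
  by rewrite mulr_ge0 ?expR_ge0// prodr_ge0.
rewrite inE /outage/= => out.
(* Markov's inequality pointwise: on the outage event the exponent [K s / eta - (s K / rho) R] is
   nonnegative. *)
rewrite /F -expR_sum -expRD -[leLHS](expR0 R) ler_expR sumrN -mulr_sumr.
rewrite -/(achievable_rate H K rho t) subr_ge0.
have -> : K%:R * (s / eta) = s * (K%:R / rho) * (rho / eta).
  by rewrite [RHS]mulrA -[s * _ * rho]mulrA divfK ?gt_eqF// mulrCA mulrA.
by rewrite ler_wpM2l// mulr_ge0 ?divr_ge0// ltW.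
Qed.

End outage_bounds.

(** * From bounds for each [n] to exponential rates *)

Section exponential_rate.
Context (R : realType).

Lemma cvg_invn : (n%:R^-1 : R) @[n --> \oo] --> 0.
Proof. by rewrite -cvg_shiftS; exact: cvg_harmonic. Qed.

(** Used to move the parameters slightly to the right of the saddle point at an arbitrarily small
    cost. *)
Lemma continuous_right_lt (f : R -> R) z : {for 0, continuous f} -> f 0 < z ->
  exists2 x, 0 < x & f x < z.
Proof.
move=> cf f0z; near (0 : R)^'+ => x; exists x; first by near: x; exact: nbhs_right_gt.
near: x; apply: (cvgr_lt (f 0)) => //.
exact: cvg_at_right_filter.
Unshelve. all: by end_near. Qed.

Lemma expR_natN_small (g z : R) : 0 < g -> 0 < z ->
  \forall n \near \oo, expR (- (n%:R * g)) <= z.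
Proof.
move=> g0 z0; near=> n.
rewrite -[leRHS]lnK ?posrE// ler_expR lerNl -ler_pdivrMr//.
by near: n; exact: nbhs_infty_ger.
Unshelve. all: by end_near. Qed.

(** For large [n] each error term is at most a quarter of the left-hand side, so the term with [p n]
    carries at least half of it. The lost factor costs [ln 2 / n], eventually at most [e].
    Positivity of [p n] comes along because the left-hand side is positive. *)
Lemma rate_le_of_lower_bound (p : R^nat) (L c g1 g2 e : R) :
  0 < g1 -> 0 < g2 -> 0 < e ->
  (forall n, (0 < n)%N -> expR (- (n%:R * L)) <= expR (- (n%:R * c)) * p n +
     expR (- (n%:R * (L + g1))) + expR (- (n%:R * (L + g2)))) ->
  \forall n \near \oo, 0 < p n /\ - ln (p n) / n%:R <= L - c + e.
Proof.
move=> g10 g20 e0 low; near=> n.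
have n0 : (0 < n)%N by near: n; exact: nbhs_infty_gt.
have n0' : 0 < n%:R :> R by rewrite ltr0n.
have := low _ n0; rewrite !mulrDr !opprD !expRD.
have s1 : expR (- (n%:R * g1)) <= 4^-1 by near: n; exact: expR_natN_small.
have s2 : expR (- (n%:R * g2)) <= 4^-1 by near: n; exact: expR_natN_small.
have x0 := expR_gt0 (- (n%:R * L)).
move=> low'.
have : expR (- (n%:R * L)) / 2 <= expR (- (n%:R * c)) * p n by nra.
rewrite [expR (- (n%:R * c))]expRN ler_pdivlMl ?expR_gt0//.
rewrite mulrA -expRD mulrC => low2.
have q0 : 0 < 2^-1 * expR (n%:R * c - n%:R * L) by rewrite mulr_gt0 ?expR_gt0.
have p0 := lt_le_trans q0 low2; split => //.
have := low2; rewrite -ler_ln ?posrE// lnM ?posrE ?expR_gt0// expRK lnV ?posrE//.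
have : ln 2 / e <= n%:R :> R by near: n; exact: nbhs_infty_ger.
by rewrite ler_pdivrMr// ler_pdivrMr//; lra.
Unshelve. all: by end_near. Qed.

(** Take logarithms and divide by [n]. The base [b] varies with [n] because the effective Chernoff
    parameter depends on the number of channels. Positivity of [p n] is a premise because [ln] has
    only a default value at 0. *)
Lemma rate_ge_of_upper_bound (p b : R^nat) (c L e : R) :
  (forall n, 0 < b n) ->
  (\forall n \near \oo, ln (b n) <= - L + e) ->
  (forall n, (0 < n)%N -> p n <= expR (n%:R * c) * b n ^+ n) ->
  \forall n \near \oo, 0 < p n -> L - c - e <= - ln (p n) / n%:R.
Proof.
move=> b0 lnb up; have := nbhs_infty_gt 0.
move: lnb; apply: filterS2 => n lb n0 p0.
have n0' : 0 < n%:R :> R by rewrite ltr0n.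
have := up _ n0.
rewrite -ler_ln ?posrE ?mulr_gt0 ?expR_gt0 ?exprn_gt0//.
rewrite lnM ?posrE ?expR_gt0 ?exprn_gt0// expRK lnXn// -[ln (b n) *+ n]mulr_natl.
rewrite ler_pdivlMr//; have := ler_wpM2l (ltW n0') lb.
by lra.
Qed.

End exponential_rate.

(** * Convergence of the normalized exponent at a saddle point *)

Section outage_exponent.
Context (R : realType) d (T : measurableType d) (P : probability T R).
Variables (H : forall K : nat, 'I_K -> {RV P >-> R[i]}) (kappa v rho eta : R).
Arguments H : clear implicits.
Hypotheses (v0 : 0 < v) (rho0 : 0 < rho).
Hypothesis H_indep : forall K, mutually_independent (H K).
Hypothesis H_law : forall K (k : 'I_K),
  has_law (H K k) (complex_normal_prob kappa%:C v).
Variable s0 : R.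
Hypothesis s0_ge0 : 0 <= s0.
Hypothesis s0_saddle : log_laplace_deriv (kappa ^+ 2) v s0 = eta^-1.

Let L := log_laplace (kappa ^+ 2) v.
Let D := log_laplace_deriv (kappa ^+ 2) v.
Let p (K : nat) : R := fine (outage_probability H K rho (rho / eta)).

Let continuous_shift (f : R -> R) (a : R) : {for s0, continuous f} ->
  {for 0, continuous (fun x => f (s0 + a * x))}.
Proof.
move=> cf; apply: continuous_comp.
  by apply: cvgD; [exact: cvg_cst|apply: cvgMl_tmp; exact: cvg_id].
by rewrite mulr0 addr0.
Qed.

Let cL : {for s0, continuous L}.
Proof. exact: continuous_log_laplace. Qed.

Let cD : {for s0, continuous D}.
Proof. exact: continuous_log_laplace_deriv. Qed.

Lemma outage_rate_le (e : R) : 0 < e ->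
  \forall K \near \oo, 0 < p K /\ - ln (p K) / K%:R <= L s0 - s0 / eta + e.
Proof.
move=> e0.
(* The tilt is at [s0 + x] and the lower level is [c = D (s0 + 2 x)]. At [x = 0] the cost is
   [L s0 - s0 / eta], because [D s0 = 1 / eta]. The factor in [1 * x] matches the form of
   [continuous_shift]. *)
have [x x0 fx] : exists2 x, 0 < x &
    L (s0 + 1 * x) - (s0 + 1 * x) * D (s0 + 2 * x) < L s0 - s0 / eta + e / 2.
  apply: (@continuous_right_lt _
    (fun x => L (s0 + 1 * x) - (s0 + 1 * x) * D (s0 + 2 * x))).
    apply: cvgB; first exact: continuous_shift.
    apply: cvgM; last exact: continuous_shift.
    by apply: (continuous_shift (f := id)); exact: cvg_id.
  by rewrite !mulr0 !addr0 /D s0_saddle ltrDl divr_gt0.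
rewrite mul1r in fx.
have m0 : 0 <= kappa ^+ 2 by exact: sqr_ge0.
have sx0 : 0 <= s0 + x by rewrite addr_ge0// ltW.
have ltx : s0 < s0 + x by rewrite ltrDl.
have ltx2 : s0 + x < s0 + 2 * x by lra.
have /andP[_ chord1] := log_laplace_chord m0 v0 s0_ge0 ltx.
have /andP[chord2 _] := log_laplace_chord m0 v0 sx0 ltx2.
rewrite s0_saddle in chord1.
set c := D (s0 + 2 * x) in fx.
(* Both gaps are positive by strict concavity: the chord from [s0] to [s0 + x] has slope below
   [1 / eta], and the one from [s0 + x] to [s0 + 2 x] has slope above [c]. Half of [e] is left for
   the factor lost in the rate lemma. *)
have := @rate_le_of_lower_bound _ p (L (s0 + x)) ((s0 + x) * c)
  (L s0 + x / eta - L (s0 + x))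
  (L (s0 + 2 * x) - x * c - L (s0 + x)) (e / 2).
have eq1 : s0 + x - s0 = x by ring.
have eq2 : s0 + 2 * x - (s0 + x) = x by ring.
rewrite eq1 in chord1; rewrite eq2 in chord2.
move=> /(_ _ _ _ _)/(filterS _) near_p; apply: near_p.
- by move=> n [pn le_pn]; split => //; apply: (le_trans le_pn); lra.
- by rewrite /L; lra.
- by rewrite /L /c /D; lra.
- by rewrite divr_gt0.
move=> K K0; rewrite !(addrC (L (s0 + x))) !subrK.
have := outage_lower eta v0 rho0 H_indep H_law c K0 s0_ge0 (ltW ltx) (ltW ltx2).
by rewrite eq1 eq2.
Qed.

Lemma outage_rate_ge (e : R) : 0 < e ->
  \forall K \near \oo, 0 < p K -> L s0 - s0 / eta - e <= - ln (p K) / K%:R.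
Proof.
move=> e0.
(* Moving to [s = s0 + x] makes the Chernoff parameter strictly positive even if [s0 = 0]. *)
have [x x0 fx] : exists2 x, 0 < x &
    - (L (s0 + 1 * x) - (s0 + 1 * x) / eta) < - (L s0 - s0 / eta) + e / 2.
  apply: (@continuous_right_lt _
    (fun x => - (L (s0 + 1 * x) - (s0 + 1 * x) / eta))).
    apply: cvgN; apply: cvgB; first exact: continuous_shift.
    apply: cvgMr_tmp.
    by apply: (continuous_shift (f := id)); exact: cvg_id.
  by rewrite !mulr0 !addr0 ltrDl divr_gt0.
rewrite mul1r in fx; set s := s0 + x in fx.
have s_gt0 : 0 < s by rewrite ltr_wpDl.
(* A makes the truncation error exp (- s A) at most exp (- L s) (exp (e / 4) - 1). *)
pose t := expR (- L s) * (expR (e / 4) - 1).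
have t0 : 0 < t by rewrite mulr_gt0 ?expR_gt0// subr_gt0 expR_gt1 divr_gt0.
pose A := Num.max 1 (- ln t / s).
have A0 : 0 < A by rewrite lt_max ltr01.
(* The truncation level [A] is fixed before [K] grows, so [s' K] tends to [s]. *)
pose s' (K : nat) := s / (1 + rho * A / K%:R).
pose b K := expR (- L (s' K)) + expR (- (s' K * A)).
have cs' : s' K @[K --> \oo] --> s.
  rewrite -[X in _ --> X]divr1; apply: cvgM; first exact: cvg_cst.
  apply: cvgV; first exact: oner_neq0.
  rewrite -[X in _ --> X]addr0; apply: cvgD; first exact: cvg_cst.
  rewrite -[X in _ --> X](mulr0 (rho * A)).
  by apply: cvgMl_tmp; exact: cvg_invn.
have cLs : {for s, continuous L} by apply: continuous_log_laplace => //; exact: ltW.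
have cb : b K @[K --> \oo] --> expR (- L s) + expR (- (s * A)).
  apply: cvgD; apply: continuous_cvg; try exact: continuous_expR.
    by apply: cvgN; exact: (cvg_comp _ _ cs' cLs).
  by apply: cvgN; apply: cvgMr_tmp.
have lim_lt : expR (- L s) + expR (- (s * A)) < expR (- L s + e / 2).
  apply: (@le_lt_trans _ _ (expR (- L s) * expR (e / 4))).
    have -> : expR (- L s) * expR (e / 4) = expR (- L s) + t.
      by rewrite /t; ring.
    rewrite lerD2l -[leRHS]lnK ?posrE// ler_expR lerNl mulrC -ler_pdivrMr//.
    by rewrite le_max lexx orbT.
  by rewrite -expRD ltr_expR ltrD2l; lra.
have b0 K : 0 < b K by rewrite addr_gt0 ?expR_gt0.
have lnb : \forall K \near \oo, ln (b K) <= - L s + e / 2.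
  near=> K; have bK : b K < expR (- L s + e / 2).
    by near: K; exact: (cvgr_lt _ cb _ lim_lt).
  by rewrite -[leRHS]expRK ler_ln ?posrE ?expR_gt0// ltW.
have up K : (0 < K)%N -> p K <= expR (K%:R * (s / eta)) * b K ^+ K.
  by move=> K0; exact: outage_upper.
have := rate_ge_of_upper_bound b0 lnb up; apply: filterS => K + pK => /(_ pK).
by lra.
Unshelve. all: by end_near. Qed.

Lemma cvg_outage_exponent :
  normalized_outage_exponent H rho eta K @[K --> \oo] -->
  (L s0 - s0 / eta)%:E.
Proof.
have pE K : outage_probability H K rho (rho / eta) = (p K)%:E.
  rewrite /p fineK// fin_num_measure//; exact: measurable_outage.
(* The bound at [e = 1] serves only for positivity: eventually the extended logarithm agrees with
   the real one. *)
have nearE : \forall K \near \oo,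
    (- ln (p K) / K%:R)%:E = normalized_outage_exponent H rho eta K.
  have := outage_rate_le ltr01; apply: filterS => K [pK _].
  by rewrite /normalized_outage_exponent pE lne_EFin.
apply: (cvg_trans (near_eq_cvg nearE)).
apply: cvg_EFin; first exact: nearW.
apply/cvgrPdist_le => e e0.
have := outage_rate_le e0; have := outage_rate_ge e0.
apply: filterS2 => K ge_rate [pK le_rate]; have := ge_rate pK.
by rewrite ler_distlC => ->.
Qed.

End outage_exponent.

(** * The exponent for Rician fading *)

Theorem mainTheorem6 (R : realType) (d : measure_display)
    (T : measurableType d) (P : probability T R)
    (H : forall K : nat, 'I_K -> {RV P >-> R[i]})
    (kappa rho eta : R)
    (kappa_gt0 : 0 < kappa) (kappa_lt1 : kappa < 1)
    (rho_gt0 : 0 < rho) (eta_ge1 : 1 <= eta)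
    (H_indep : forall K : nat, mutually_independent (H K))
    (H_law : forall (K : nat) (k : 'I_K),
      has_law (H K k) (complex_normal_prob kappa%:C (1 - kappa ^+ 2))) :
  cvgn (normalized_outage_exponent H rho eta) /\
  wideband_outage_exponent H rho eta =
    (((1 - kappa ^+ 2) * eta)^-1
     + kappa ^+ 2 / (1 - kappa ^+ 2)
     - Num.sqrt (1 + 4 * kappa ^+ 2 / ((1 - kappa ^+ 2) ^+ 2 * eta))
     + ln ((1 - kappa ^+ 2) * eta / 2)
     + ln (1 + Num.sqrt (1 + 4 * kappa ^+ 2
                               / ((1 - kappa ^+ 2) ^+ 2 * eta))))%:E.
Proof.
have v0 : 0 < 1 - kappa ^+ 2 by rewrite subr_gt0 expr_lt1// ltW.
(* The mean gain is normalized to 1, so the level [1 / eta] is at most the mean. *)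
have mv : kappa ^+ 2 + (1 - kappa ^+ 2) = 1 by rewrite addrC subrK.
have [s [s0 saddle rateE]] :=
  rician_saddle_point (sqr_ge0 kappa) v0 mv eta_ge1.
have cvg_rate := cvg_outage_exponent v0 rho_gt0 H_indep H_law s0 saddle.
by rewrite -rateE; split; [apply/cvg_ex; eexists; exact: cvg_rate|exact/cvg_lim].
Qed.
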